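(* For any integer $r$, let $\mathcal I_r = \left( \frac 23\cdot 3^r, \frac 32 \cdot 3^r \right)$. If $m \in \mathcal A/\mathcal A$, then $m \in \mathcal I_r$ for some integer $r$. Moreover, for this $r$, if $m = \frac{p(3)}{q(3)}$ for some $p(x),q(x) \in \mathcal P$, then there exists an integer $e$ such that $p(x) \in \mathcal P_{e+r}$ and $q(x) \in \mathcal P_{e}$.
   Context: For $r \ge 1$, let $\mathcal P_r = \left\{ 1 + \sum_{k=1}^{r-1} \epsilon_k x^k + x^r : \epsilon_k \in \{0,1\} \right\}$, let $\mathcal P_0=\{1\}$, and let $\mathcal P = \{1\} \cup \bigcup_{r=1}^\infty \mathcal P_r$ (the polynomials with coefficients in $\{0,1\}$ and constant term $1$, called Newman polynomials; $\mathcal P_r$ consists of those of degree $r$). Let $\mathcal A = \{p(3) : p \in \mathcal P\}$, i.e. $\mathcal A = \{1\}\cup\bigcup_{r\ge 1}\left\{1+\sum_{k=1}^{r-1}\epsilon_k 3^k+3^r : \epsilon_k\in\{0,1\}\right\}$. The set $\mathcal A/\mathcal A$ is the set of integers congruent to $1 \bmod 3$ that can be written as a quotient of two elements of $\mathcal A$. *)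

(* Defs.v *)
From mathcomp Require Import all_boot all_order all_algebra.
From mathcomp Require Import classical_sets.

Set Implicit Arguments.
Unset Strict Implicit.
Unset Printing Implicit Defensive.

Import Order.TTheory GRing.Theory Num.Theory.
Local Open Scope classical_set_scope.
Local Open Scope ring_scope.

Definition newman_deg (r : nat) : set {poly int} :=
  if r is 0%N then [set 1]
  else [set p | exists eps : nat -> bool,
         p = 1 + \sum_(1 <= k < r) (eps k)%:R *: 'X^k + 'X^r].

(* Indices in the theorem range over all integers; there is no Newman
   polynomial of negative degree. *)
Definition newman_degz (r : int) : set {poly int} :=
  if r is Posz n then newman_deg n else set0.

Definition newman : set {poly int} :=
  [set 1] `|` \bigcup_(r in [set r | (1 <= r)%N]) newman_deg r.

Definition newman_values : set int := [set p.[3] | p in newman].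

(* Every element of [newman_values] is positive, so the quotient in [rat]
   never involves the convention x / 0 = 0. *)
Definition newman_quotients : set int :=
  [set m | (m = 1 %[mod 3])%Z /\
     exists a b, [/\ newman_values a, newman_values b & m%:Q = a%:Q / b%:Q]].

Definition newman_interval (r : int) : interval rat :=
  `](2 / 3) * 3 ^ r, (3 / 2) * 3 ^ r[.

(* Main.v *)
(* A Newman polynomial [p] of degree [d] satisfies
   [3^d <= p(3) <= (3^(d+1) - 1)/2 < 3/2 * 3^d], so a quotient of values in
   degrees [s] and [t] lies in the interval [I_(s-t)].  The intervals [I_r] are
   pairwise disjoint since [3/2 * 3^r < 2/3 * 3^(r+1)], hence [s - t] depends
   only on the quotient. *)
Require Import Defs.
From mathcomp Require Import all_boot all_order all_algebra.
From mathcomp Require Import classical_sets.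
From mathcomp Require Import lra zify.

Set Implicit Arguments.
Unset Strict Implicit.
Unset Printing Implicit Defensive.

Import Order.TTheory GRing.Theory Num.Theory.
Local Open Scope classical_set_scope.
Local Open Scope ring_scope.

Lemma newman_has_deg (p : {poly int}) :
  newman p -> exists n : nat, newman_deg n p.
Proof. by case=> [p1|[n _ pn]]; [exists 0%N | exists n]. Qed.

(** A new term adds at most [2 * 3 ^+ n.+1] to the doubled sum, which exactly turns the bound
    [3 ^+ n.+1] into [3 ^+ n.+2]. Doubling avoids the fraction 1/2 in [int]. *)
Lemma ternary_sum_bounds (eps : nat -> bool) (n : nat) :
  let s : int := \sum_(1 <= k < n.+1) (eps k)%:R * 3 ^+ k in
  0 <= s /\ 2 * (1 + s) < 3 ^+ n.+1.
Proof.
elim: n => [|n [s_ge0 s_lt]] /=; first by rewrite big_geq.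
rewrite big_nat_recr //= [3 ^+ n.+2]exprS.
have : (0 : int) < 3 ^+ n.+1 by rewrite exprn_gt0.
by case: (eps n.+1); rewrite /= ?mulr1n ?mulr0n ?mul1r ?mul0r; lra.
Qed.

Lemma newman_deg_bounds (n : nat) (p : {poly int}) :
  newman_deg n p -> 3 ^+ n <= p.[3] /\ 2 * p.[3] < 3 * 3 ^+ n.
Proof.
case: n => [->|n [eps ->]]; first by rewrite hornerC.
rewrite !hornerE horner_sum.
have -> : \sum_(1 <= k < n.+1) ((eps k)%:R *: 'X^k).[3] =
          \sum_(1 <= k < n.+1) (eps k)%:R * 3 ^+ k :> int.
  by apply: eq_bigr => k _; rewrite hornerZ hornerXn.
have [] := ternary_sum_bounds eps n; lra.
Qed.

Lemma newman_quotient_interval (s t : nat) (p q : {poly int}) :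
  newman_deg s p -> newman_deg t q ->
  p.[3]%:Q / q.[3]%:Q \in newman_interval (s%:Z - t%:Z).
Proof.
move=> /newman_deg_bounds[ps ps'] /newman_deg_bounds[qt qt'].
move: ps ps' qt qt'.
rewrite -!(ler_int rat) -!(ltr_int rat) !rmorphM /= !rmorphXn /=.
set a := p.[3]%:~R; set b := q.[3]%:~R => ps ps' qt qt'.
have s_gt0 : (0 : rat) < 3 ^+ s by rewrite exprn_gt0.
have t_gt0 : (0 : rat) < 3 ^+ t by rewrite exprn_gt0.
have b_gt0 : 0 < b by apply: lt_le_trans qt.
rewrite in_itv /= expfzDr // -exprnN -exprnP.
set u := 3 ^+ s in ps ps' s_gt0 *; set v := 3 ^+ t in qt qt' t_gt0 *.
rewrite ltr_pdivlMr // ltr_pdivrMr // !mulrA ![_ / v * b]mulrAC.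
(* With denominators cleared, the goals are [2 / 3 * u * b < a * v], from [u <= a] and
   [2 * b < 3 * v], and [a * v < 3 / 2 * u * b], from [2 * a < 3 * u] and [v <= b]. *)
rewrite ltr_pdivrMr // ltr_pdivlMr //; apply/andP; split; nra.
Qed.

Lemma newman_interval_inj (x : rat) (r s : int) :
  x \in newman_interval r -> x \in newman_interval s -> r = s.
Proof.
wlog le_rs : r s / r <= s.
  by move=> H; case: (lerP r s) => [|/ltW] /H // {}H xr xs; rewrite H.
rewrite !in_itv /= => /andP[_ xr] /andP[xs _].
apply/eqP; rewrite eq_le le_rs leNgt /=; apply/negP => lt_rs.
(* Integrality gives [r + 1 <= s], so the lower end for [s] is at least [2 * 3 ^ r], above the upper
   end [(3 / 2) * 3 ^ r] for [r]. *)
have : (3 : rat) ^ (r + 1) <= 3 ^ s by rewrite ler_weXz2l //; lia.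
have : (0 : rat) < 3 ^ r by rewrite exprz_gt0.
rewrite expfzDr // expr1z; lra.
Qed.

Theorem theorem1p2 (m : int) (hm : newman_quotients m) :
  exists r : int,
    m%:Q \in newman_interval r /\
    (forall p q : {poly int}, newman p -> newman q ->
       m%:Q = p.[3]%:Q / q.[3]%:Q ->
       exists e : int, newman_degz (e + r) p /\ newman_degz e q).
Proof.
case: hm => _ [_ [_ [[p Np <-] [q Nq <-] mE]]].
have [s ps] := newman_has_deg Np; have [t qt] := newman_has_deg Nq.
have mI : m%:Q \in newman_interval (s%:Z - t%:Z).
  by rewrite mE; exact: newman_quotient_interval.
(* One representation of [m] fixes [r]; any other is then compared with it. *)
exists (s%:Z - t%:Z); split=> // p' q' Np' Nq' mE'.
have [s' ps'] := newman_has_deg Np'; have [t' qt'] := newman_has_deg Nq'.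
have mI' := newman_quotient_interval ps' qt'; rewrite -mE' in mI'.
(* The witness [e] is the degree of the denominator; disjointness forces [s - t = s' - t'], so
   [e + r] is [s']. *)
exists t'%:Z; split=> //.
by rewrite (newman_interval_inj mI mI') addrC subrK.
Qed.
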